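(* Let $T$ be an ergodic automorphism of a Lebesgue space $(X,\Sigma,\mu)$ and let $g\in\mathcal{G}_0$. (1) If $0<\overline{C}(g)<\infty$, then $h_\mu(g,T)=\overline{C}(g)\cdot h_\mu(T)$ when $h_\mu(T)<\infty$, and $h_\mu(g,T)=\infty$ when $h_\mu(T)=\infty$. (2) If $g\in\mathcal{G}_0^0$, then $h_\mu(g,T)=0$. (3) If $\overline{C}(g)=\infty$ and $h_\mu(T)>0$, then $h_\mu(g,T)=\infty$.
   Context: $\mathcal{G}_0$ is the set of concave functions $g:[0,1]\to\mathbb{R}$ with $g(0)=\lim_{x\to0^+}g(x)=0$. Let $\eta(x)=-x\log x$ for $x>0$ and $\eta(0)=0$. Put $\overline{C}(g)=\limsup_{x\to0^+}g(x)/\eta(x)$ and $\underline{C}(g)=\liminf_{x\to0^+}g(x)/\eta(x)$. Define $\mathcal{G}_0^0=\{g\in\mathcal{G}_0:\lim_{x\to0^+}g(x)/\eta(x)=0\}$. For a measure-preserving map $T$ of a probability space $(X,\Sigma,\mu)$ and a finite measurable partition $\mathcal{P}$, let $\mathcal{P}_n=\mathcal{P}\vee T^{-1}\mathcal{P}\vee\dots\vee T^{-(n-1)}\mathcal{P}$ and $H(g,\mathcal{P})=\sum_{A\in\mathcal{P}}g(\mu(A))$. The dynamical $g$-entropy is $h_\mu(g,T,\mathcal{P})=\limsup_{n\to\infty}\frac1n H(g,\mathcal{P}_n)$. The measure-theoretic $g$-entropy is $h_\mu(g,T)=\sup_{\mathcal{P}}h_\mu(g,T,\mathcal{P})$, the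 supremum taken over finite measurable partitions. $h_\mu(T)$ denotes the Kolmogorov–Sinai entropy, which equals $h_\mu(\eta,T)$. *)

(* Defs.v *)
From HB Require Import structures.
From mathcomp Require Import all_boot all_order all_algebra.
From mathcomp Require Import all_classical all_reals all_analysis.
Set Implicit Arguments. Unset Strict Implicit. Unset Printing Implicit Defensive.
Import Order.TTheory GRing.Theory Num.Theory.
Import numFieldNormedType.Exports.
Local Open Scope classical_set_scope.
Local Open Scope ring_scope.

Section Defs.
Context {R : realType}.

Definition eta (x : R) : R := if x <= 0 then 0 else - (x * ln x).

Definition concave01 (g : R -> R) : Prop :=
  forall x y t : R, 0 <= x <= 1 -> 0 <= y <= 1 -> 0 <= t <= 1 ->
    t * g x + (1 - t) * g y <= g (t * x + (1 - t) * y).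

Definition G0 (g : R -> R) : Prop :=
  concave01 g /\ g 0 = 0 /\ g x @[x --> 0^'+] --> 0.

Definition Cbar (g : R -> R) : \bar R :=
  limf_esup (fun x => (g x / eta x)%:E) 0^'+.

Definition G00 (g : R -> R) : Prop :=
  G0 g /\ (g x / eta x) @[x --> 0^'+] --> 0.

Context {d : measure_display} {X : measurableType d}.

Definition is_partition (P : seq (set X)) : Prop :=
  (forall A, A \in P -> measurable A) /\
  (forall i j, (i < size P)%N -> (j < size P)%N -> i <> j ->
     nth set0 P i `&` nth set0 P j = set0) /\
  (\bigcup_(A in [set A | A \in P]) A = setT).

(* P_n = P v T^{-1}P v ... v T^{-(n-1)}P, as a list of blocks
   (possibly with empty blocks, which contribute g(0) = 0) *)
Fixpoint join_iter (T : X -> X) (P : seq (set X)) (n : nat) : seq (set X) :=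
  match n with
  | 0 => [:: setT]
  | n'.+1 => [seq A `&` (iter n' T @^-1` B) | A <- join_iter T P n', B <- P]
  end.

Definition Hg (mu : {measure set X -> \bar R}) (g : R -> R) (P : seq (set X)) : R :=
  \sum_(A <- P) g (fine (mu A)).

Definition dyn_gentropy (mu : {measure set X -> \bar R}) (g : R -> R)
    (T : X -> X) (P : seq (set X)) : \bar R :=
  limn_esup (fun n => ((n%:R)^-1 * Hg mu g (join_iter T P n))%:E).

Definition gentropy (mu : {measure set X -> \bar R}) (g : R -> R) (T : X -> X)
  : \bar R :=
  ereal_sup [set dyn_gentropy mu g T P | P in is_partition].

Definition KS_entropy (mu : {measure set X -> \bar R}) (T : X -> X) : \bar R :=
  gentropy mu eta T.

Definition automorphism (mu : {measure set X -> \bar R}) (T : X -> X) : Prop :=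
  exists Tinv : X -> X,
    cancel T Tinv /\ cancel Tinv T /\
    measurable_fun setT T /\ measurable_fun setT Tinv /\
    (forall A, measurable A -> mu (T @^-1` A) = mu A) /\
    (forall A, measurable A -> mu (Tinv @^-1` A) = mu A).

Definition ergodic (mu : {measure set X -> \bar R}) (T : X -> X) : Prop :=
  forall A, measurable A -> T @^-1` A = A -> (mu A = 0)%E \/ (mu A = 1)%E.

(* Lebesgue space: a complete probability space isomorphic mod 0 to the
   completion of (R, Borel, nu) for some Borel probability measure nu on R. *)
Definition complete_measure (mu : {measure set X -> \bar R}) : Prop :=
  forall N A, measurable N -> mu N = 0%E -> A `<=` N -> measurable A.

Definition lebesgue_space (mu : probability X R) : Prop :=
  complete_measure mu /\
  exists (nu : probability R R) (phi : X -> R) (X0 : set X) (Y0 : set R),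
    [/\ measurable X0 /\ mu X0 = 1%E, measurable Y0 /\ nu Y0 = 1%E,
        (forall x, X0 x -> Y0 (phi x)) /\
        (forall x y, X0 x -> X0 y -> phi x = phi y -> x = y) /\
        (forall y, Y0 y -> exists2 x, X0 x & phi x = y),
        measurable_fun setT phi /\
        (forall B : set R, measurable B -> mu (phi @^-1` B) = nu B)
      & (forall A, measurable A -> A `<=` X0 ->
           exists B N : set R, [/\ measurable B, measurable N, nu N = 0%E &
             (phi @` A) `\` B `|` (B `\` (phi @` A)) `<=` N])].
End Defs.

(* Main.v *)
Require Import Defs.
From HB Require Import structures.
From mathcomp Require Import all_boot all_order all_algebra.
From mathcomp Require Import all_classical all_reals all_analysis.
From mathcomp Require Import ring lra.
Set Implicit Arguments. Unset Strict Implicit. Unset Printing Implicit Defensive.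
Import Order.TTheory GRing.Theory Num.Theory.
Import numFieldNormedType.Exports.
Local Open Scope classical_set_scope.

(** Upper bounds are soft: if [g <= C * eta] near [0], concavity gives
    [g x <= C * eta x + K * x] on [[0, 1]], and the linear term contributes at
    most [K] to [H(g, P_n)].

    For the lower bound, [g x / x] is nonincreasing, so [g x >= C * eta x] at a
    single small [x] bounds [g y] below by [y * C * - ln x] for all [y <= x].
    It remains to know that, for [c < h(T, P)], almost all of the mass of [P_n]
    sits on blocks of measure less than [exp (- n c)]; this half of the
    Shannon-McMillan theorem is proved directly. If it fails, ergodicity implies
    that almost every point lies, for infinitely many [n], in a block of [P_n]
    of measure at least [exp (- n c - K)]. Long names are then parsed into such
    heavy blocks and few isolated letters; the weights of the parsings satisfy
    Kraft's inequality, and Gibbs' inequality gives [h(T, P) <= c]. *)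

(** * Words over a finite alphabet and Gibbs' inequality *)

Section Words.
Local Open Scope ring_scope.
Variables (R : realType) (A : eqType).
Implicit Types (P : seq A) (p : seq A -> R) (w : seq A).

Fixpoint words P n : seq (seq A) :=
  if n is n'.+1 then [seq a :: w | a <- P, w <- words P n'] else [:: [::]].

Lemma mem_words P n w : (w \in words P n) = (size w == n) && all (mem P) w.
Proof.
elim: n w => [|n IHn] [|a w] //=.
  by apply/negbTE/allpairsP => -[[b v]] [].
rewrite eqSS; apply/allpairsP/idP => [[[b v]] /= [Pb Pv [-> ->]]|].
  by move: Pv; rewrite IHn Pb.
case/and3P=> sw Pa Pw; exists (a, w); split => //=.
by rewrite IHn sw.
Qed.

Lemma big_words_cons P n (F : seq A -> R) :
  \sum_(w <- words P n.+1) F w = \sum_(a <- P) \sum_(w <- words P n) F (a :: w).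
Proof. by rewrite /= big_allpairs_dep. Qed.

#[global] Arguments words : simpl never.

Lemma size_words P n w : w \in words P n -> size w = n.
Proof. by rewrite mem_words => /andP[/eqP]. Qed.

Lemma words_cat P n m u v :
  u \in words P n -> v \in words P m -> u ++ v \in words P (n + m).
Proof.
rewrite !mem_words size_cat all_cat => /andP[/eqP-> ->] /andP[/eqP-> ->].
by rewrite eqxx.
Qed.

Lemma big_words_cat P n m (F : seq A -> R) :
  \sum_(w <- words P (n + m)) F w =
  \sum_(u <- words P n) \sum_(v <- words P m) F (u ++ v).
Proof.
elim: n F => [|n IHn] F; first by rewrite add0n big_seq1.
rewrite addSn !big_words_cons; apply: eq_bigr => a _.
by rewrite IHn.
Qed.

Lemma big_words_rcons P n (F : seq A -> R) :
  \sum_(w <- words P n.+1) F w =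
  \sum_(w <- words P n) \sum_(a <- P) F (rcons w a).
Proof.
rewrite -addn1 big_words_cat; apply: eq_bigr => w _.
rewrite big_words_cons; apply: eq_bigr => a _.
by rewrite big_seq1 cats1.
Qed.

(** Consistency is asked for a letter put in front; for cylinder weights this is the invariance of
    the measure. *)
Definition stationary P p := [/\ forall w, 0 <= p w, p [::] = 1 &
  forall n w, w \in words P n -> \sum_(a <- P) p (a :: w) = p w].

Lemma stationary_sum1 P p n : stationary P p -> \sum_(w <- words P n) p w = 1.
Proof.
case=> p0 p1 pS; elim: n => [|n IHn]; first by rewrite big_seq1.
rewrite big_words_cons exchange_big /= -[RHS]IHn.
by apply: eq_big_seq => w /pS.
Qed.

Lemma stationary_cons_le P p n a w : stationary P p -> w \in words P n ->
  a \in P -> p (a :: w) <= p w.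
Proof.
move=> [p0 p1 pS] /pS <- aP.
by rewrite (big_rem a)//= lerDl sumr_ge0.
Qed.

(** This is [exp t >= 1 + t] at [t = - l - ln x], multiplied by [x]. Summed over a probability
    vector, the terms [expR (- l) - x] are at most [0] by Kraft's inequality. *)
Lemma eta_le_kraft (x l : R) : 0 <= x -> Defs.eta x <= x * l + expR (- l) - x.
Proof.
move=> x0; rewrite /Defs.eta; case: ifPn => [x_le0|].
  have -> : x = 0 by apply/eqP; rewrite eq_le x0 x_le0.
  by rewrite mul0r add0r subr0 expR_ge0.
rewrite -ltNge => xp.
have := expR_ge1Dx (- l - ln x).
rewrite expRD [expR (- ln x)]expRN lnK ?posrE// => /(ler_wpM2l x0).
rewrite [leRHS]mulrCA mulfV ?gt_eqF// mulr1; lra.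
Qed.

Lemma entropy_le_kraft P p n (l : seq A -> R) : stationary P p ->
  \sum_(w <- words P n) expR (- l w) <= 1 ->
  \sum_(w <- words P n) Defs.eta (p w) <= \sum_(w <- words P n) p w * l w.
Proof.
move=> Pp; have [p0 _ _] := Pp; move=> H.
apply: (@le_trans _ _ (\sum_(w <- words P n) (p w * l w + expR (- l w) - p w))).
  by apply: ler_sum => w _; exact: eta_le_kraft.
rewrite sumrB big_split /= (stationary_sum1 _ Pp).
by move: H; set u := \sum_(_ <- _) _; set v := \sum_(_ <- _) _; lra.
Qed.

Lemma sum_words_const P n (c : R) :
  \sum_(w <- words P n) c = (size P)%:R ^+ n * c.
Proof.
elim: n => [|n IHn]; first by rewrite big_seq1 expr0 mul1r.
rewrite big_words_cons (eq_bigr (fun=> (size P)%:R ^+ n * c))//.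
by rewrite big_const_seq count_predT iter_addr_0 -[LHS]mulr_natl exprS mulrA.
Qed.

Lemma stationary_size_gt0 P p : stationary P p -> (0 < size P)%N.
Proof.
move=> /(stationary_sum1 1); case: P => //=.
by rewrite big_nil => /esym/eqP; rewrite oner_eq0.
Qed.

Lemma ln_double_size_ge0 P p : stationary P p ->
  0 <= ln ((size P)%:R *+ 2) :> R.
Proof.
move=> /stationary_size_gt0 k0; rewrite ln_ge0// -[leRHS]mulr_natr -natrM ler1n.
by rewrite muln_gt0 k0.
Qed.

Lemma entropy_le_ln_size P p n : stationary P p ->
  \sum_(w <- words P n) Defs.eta (p w) <= n%:R * ln (size P)%:R.
Proof.
move=> Pp; have k0 : 0 < (size P)%:R :> R.
  by rewrite ltr0n (stationary_size_gt0 Pp).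
apply: le_trans (entropy_le_kraft (l := fun=> n%:R * ln (size P)%:R) Pp _) _.
  rewrite sum_words_const expRN expRM_natl lnK//.
  by rewrite mulfV// gt_eqF// exprn_gt0.
by rewrite -mulr_suml (stationary_sum1 _ Pp) mul1r.
Qed.

(** * Coding by heavy blocks and single letters *)

Section Code.
Variables (P : seq A) (p : seq A -> R) (m : nat) (c e : R).

(** Short refers to code length: a prefix of weight at least [exp (- n c)] costs at most [c] per
    letter. *)
Definition has_short_prefix w :=
  has (fun n => expR (- (n%:R * c)) <= p (take n w)) (index_iota m (size w).+1).

(** An upper bound for the single letters in a greedy parsing: bad positions covered by an earlier
    block are counted as well. *)
Fixpoint bad_count w : nat :=
  if w is _ :: w' then ~~ has_short_prefix w + bad_count w' else 0.

(* The total weight of the parsings of [w] into single letters and blocks of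
   length at least [m]; [f] is fuel, at least the length of [w]. *)
Fixpoint parse_weight (f : nat) w : R :=
  if f is f'.+1 then
    if w is _ :: w' then
      ((size P)%:R *+ 2)^-1 * parse_weight f' w' +
      \sum_(m <= n < (size w).+1)
        expR (- e) ^+ n * p (take n w) * parse_weight f' (drop n w)
    else 1
  else 1.

Hypothesis stP : stationary P p.
Hypothesis m_gt0 : (0 < m)%N.
Hypothesis c_ge0 : 0 <= c.
Hypothesis e_gt0 : 0 < e.
Hypothesis geom : forall N, \sum_(m <= n < N) expR (- e) ^+ n <= 2^-1.

Lemma parse_weight_ge0 f w : 0 <= parse_weight f w.
Proof.
have [p0 _ _] := stP.
elim: f w => [|f IHf] [|a w] //=.
rewrite addr_ge0 ?mulr_ge0 ?invr_ge0 ?mulrn_wge0//.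
by apply: sumr_ge0 => n _; rewrite !mulr_ge0 ?exprn_ge0 ?expR_ge0.
Qed.

(** Kraft's inequality, by induction on the fuel. The letter branch contributes at most [1/2]; for
    each block length the weights [p] sum to [1], so by [geom] the blocks contribute at most the
    other half. *)
Lemma parse_weight_sum f N : (N <= f)%N ->
  \sum_(w <- words P N) parse_weight f w <= 1.
Proof.
have [p0 _ _] := stP.
elim: f N => [|f IHf] [|N] // Nf; rewrite ?big_seq1//.
have k0 : (size P)%:R != 0 :> R.
  by rewrite pnatr_eq0 -lt0n (stationary_size_gt0 stP).
rewrite (eq_big_seq (fun w => ((size P)%:R *+ 2)^-1 * parse_weight f (behead w) +
   \sum_(m <= n < N.+2)
        expR (- e) ^+ n * p (take n w) * parse_weight f (drop n w))); last first.
  by move=> [|a w] /size_words //= [->].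
rewrite big_split /= big_words_cons /=.
have -> : (1 : R) = 2^-1 + 2^-1 by field.
apply: lerD.
  under eq_bigr do rewrite -mulr_sumr.
  rewrite big_const_seq count_predT iter_addr_0 -[leLHS]mulr_natl mulrA.
  rewrite (_ : _ * _^-1 = 2^-1); last by field.
  by rewrite ler_piMr// IHf.
rewrite exchange_big /=; apply: le_trans (geom N.+2).
rewrite big_nat_cond [leRHS]big_nat_cond; apply: ler_sum => n /andP[/andP[mn nN] _].
rewrite -(subnKC (ltnSE nN)) big_words_cat /=.
rewrite (eq_big_seq (fun u => expR (- e) ^+ n * p u *
   \sum_(v <- words P (N.+1 - n)) parse_weight f v)); last first.
  move=> u /size_words su; rewrite mulr_sumr; apply: eq_bigr => v _.
  by rewrite take_size_cat// drop_size_cat.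
rewrite -mulr_suml -mulr_sumr (stationary_sum1 _ stP) mulr1.
rewrite ler_piMr ?exprn_ge0 ?expR_ge0// IHf//.
by rewrite leq_subLR -addn1 addnC leq_add// (leq_trans m_gt0).
Qed.

Lemma bad_count_drop n w : (bad_count (drop n w) <= bad_count w)%N.
Proof.
elim: n w => [|n IHn] [|a w] //.
by rewrite [drop _ _]/= (leq_trans (IHn w))//= leq_addl.
Qed.

(** Each letter is allotted [c] for the weights of blocks and [e] for announcing their lengths; a
    bad position adds the price of a single letter. *)
Definition code_length w : R :=
  (size w)%:R * (c + e) + ln ((size P)%:R *+ 2) * (bad_count w)%:R.

(** A single parsing suffices, the greedy one: remove a heavy block from the front if there is one,
    otherwise one letter. The other terms of [parse_weight] are nonnegative. *)
Lemma code_length_kraft f w : (size w <= f)%N ->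
  expR (- code_length w) <= parse_weight f w.
Proof.
have [p0 _ _] := stP.
have k0 : 0 < (size P)%:R *+ 2 :> R.
  by rewrite pmulrn_rgt0// ltr0n (stationary_size_gt0 stP).
have lnk0 := ln_double_size_ge0 stP.
elim: f w => [|f IHf] [|a w] wf //=;
  rewrite ?[code_length [::]]/code_length ?mul0r ?mulr0 ?addr0 ?oppr0 ?expR0//.
have [/hasP[n]|nsp] := boolP (has_short_prefix (a :: w)).
  rewrite mem_index_iota => /andP[mn nw] Hn.
  apply: ler_wpDl; first by rewrite mulr_ge0 ?invr_ge0 ?parse_weight_ge0 1?ltW.
  rewrite (bigD1_seq n) ?mem_index_iota ?mn ?iota_uniq//=.
  apply: ler_wpDr.
    by apply: sumr_ge0 => i _; rewrite !mulr_ge0 ?exprn_ge0 ?expR_ge0 ?parse_weight_ge0.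
  apply: (@le_trans _ _ (expR (- e) ^+ n * expR (- (n%:R * c)) *
     expR (- code_length (drop n (a :: w))))).
    rewrite -expRM_natl -!expRD ler_expR /code_length size_drop natrB; last by [].
    have := ler_wpM2l lnk0 (_ : (bad_count (drop n (a :: w)))%:R <= (bad_count (a :: w))%:R :> R).
    rewrite ler_nat => /(_ (bad_count_drop _ _)) H.
    by rewrite mulrBl; lra.
  rewrite ler_pM ?mulr_ge0 ?exprn_ge0 ?expR_ge0//.
    by rewrite ler_wpM2l ?exprn_ge0 ?expR_ge0.
  apply: IHf; rewrite size_drop leq_subLR (leq_trans wf)//.
  by rewrite -add1n leq_add2r (leq_trans m_gt0).
apply: ler_wpDr.
  by apply: sumr_ge0 => i _; rewrite !mulr_ge0 ?exprn_ge0 ?expR_ge0 ?parse_weight_ge0.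
(* The factor of the letter branch is what the bad first position adds to [code_length]. *)
apply: (@le_trans _ _ (((size P)%:R *+ 2)^-1 * expR (- code_length w))).
  rewrite -{1}(lnK k0) -expRN -expRD ler_expR /code_length /= nsp.
  rewrite natrD -[(size w).+1]addn1 [(size w + 1)%:R]natrD /=.
  rewrite -subr_ge0 [X in 0 <= X](_ : _ = c + e); last by rewrite mulr1n; ring.
  exact: (addr_ge0 c_ge0 (ltW e_gt0)).
by apply: ler_wpM2l; [rewrite invr_ge0 ltW|exact: IHf].
Qed.

(** By stationarity, a suffix of length at least [M] is bad with probability at most [dl]; shorter
    suffixes are charged [1] each. *)
Lemma expected_bad_count M (dl : R) : 0 <= dl ->
  (forall L, (M <= L)%N ->
     \sum_(w <- words P L | ~~ has_short_prefix w) p w <= dl) ->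
  forall N, \sum_(w <- words P N) p w * (bad_count w)%:R <= (minn N M)%:R + N%:R * dl.
Proof.
have [p0 _ pS] := stP; move=> dl0 Hdl; elim=> [|N IHN].
  by rewrite big_seq1 mulr0 mul0r addr0 ler0n.
have -> : \sum_(w <- words P N.+1) p w * (bad_count w)%:R =
    \sum_(w <- words P N.+1 | ~~ has_short_prefix w) p w +
    \sum_(w <- words P N) p w * (bad_count w)%:R.
  rewrite [X in _ = X + _]big_mkcond !big_words_cons /=.
  rewrite [X in _ + X](_ : _ = \sum_(a <- P) \sum_(w <- words P N)
      p (a :: w) * (bad_count w)%:R); last first.
    rewrite exchange_big /=; apply: eq_big_seq => w /pS <-.
    by rewrite mulr_suml.
  rewrite -big_split /=; apply: eq_bigr => a _.
  rewrite -big_split /=; apply: eq_bigr => w _.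
  by rewrite natrD mulrDr; case: ifP => _; rewrite ?mulr1 ?mulr0.
have [NM|MN] := leqP N.+1 M.
  rewrite -addn1 !natrD -addrA [X in _ <= X](_ : _ =
    1 + (N%:R + N%:R * dl) + dl); last by ring.
  rewrite ler_wpDr//; apply: lerD.
    apply: le_trans (_ : \sum_(w <- words P (N + 1)) p w <= _).
      by rewrite big_mkcond; apply: ler_sum => w _; case: ifP.
    by rewrite (stationary_sum1 _ stP).
  by rewrite (le_trans IHN)// lerD2r ler_nat geq_minl.
rewrite -addn1 natrD mulrDl mul1r addrA addrC.
apply: lerD; first by apply: Hdl; rewrite addn1 ltnW.
by rewrite (le_trans IHN)// lerD2r ler_nat geq_minr.
Qed.

Lemma entropy_le_code M (dl : R) : 0 <= dl ->
  (forall L, (M <= L)%N ->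
     \sum_(w <- words P L | ~~ has_short_prefix w) p w <= dl) ->
  forall N, \sum_(w <- words P N) Defs.eta (p w) <=
    N%:R * (c + e) + ln ((size P)%:R *+ 2) * (M%:R + N%:R * dl).
Proof.
move=> dl0 Hdl N.
have lnk0 := ln_double_size_ge0 stP.
apply: le_trans (entropy_le_kraft (l := code_length) stP _) _.
  apply: le_trans (parse_weight_sum (leqnn N)).
  rewrite big_seq [leRHS]big_seq ler_sum// => w /size_words sw.
  by rewrite code_length_kraft// sw.
rewrite (eq_big_seq (fun w => p w * (N%:R * (c + e)) +
  ln ((size P)%:R *+ 2) * (p w * (bad_count w)%:R))); last first.
  by move=> w /size_words sw; rewrite /code_length sw; ring.
rewrite big_split /= -mulr_suml (stationary_sum1 _ stP) mul1r -mulr_sumr.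
rewrite lerD2l ler_wpM2l//.
apply: le_trans (expected_bad_count dl0 Hdl N) _.
by rewrite lerD2r ler_nat geq_minr.
Qed.

End Code.
End Words.

(** * Upper limits along a filter *)

Section Limsup.
Local Open Scope ereal_scope.
Variables (R : realType) (T : choiceType) (X : filteredType T).
Implicit Types (f : X -> \bar R) (F : set (set X)).

Lemma limf_esup_le f F (y : \bar R) : F [set x | f x <= y] -> limf_esup f F <= y.
Proof.
move=> Fy; apply: ge_ereal_inf; exists (ereal_sup (f @` [set x | f x <= y])).
  by exists [set x | f x <= y].
by apply: ge_ereal_sup => _ [x /= xy <-].
Qed.

Lemma limf_esup_lt f F (y : \bar R) : Filter F ->
  limf_esup f F < y -> F [set x | f x < y].
Proof.
move=> FF /ereal_inf_lt[_ [V FV <-]] Vy.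
apply: filterS FV => x Vx /=; apply: le_lt_trans Vy.
by apply: ereal_sup_ubound; exists x.
Qed.

Lemma limf_esup_gt f F (y : \bar R) V :
  y < limf_esup f F -> F V -> exists2 x, V x & y < f x.
Proof.
move=> yf FV; have : y < ereal_sup (f @` V).
  by apply: lt_le_trans yf _; apply: ereal_inf_lbound; exists V.
by move=> /ereal_sup_gt[_ [x Vx <-] yfx]; exists x.
Qed.

Lemma le_limf_esup f F (y : \bar R) :
  (forall V, F V -> exists2 x, V x & y <= f x) -> y <= limf_esup f F.
Proof.
move=> H; apply: le_ereal_inf_tmp => _ [V FV <-].
have [x Vx yfx] := H _ FV; apply: le_trans yfx _.
by apply: ereal_sup_ubound; exists x.
Qed.

End Limsup.

(** * Cylinders of a partition *)

Section Cylinders.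
Local Open Scope ring_scope.
Variables (R : realType) (d : measure_display) (X : measurableType d).
Variables (mu : probability X R) (T : X -> X) (P : seq (set X)).
Hypothesis mT : measurable_fun setT T.
Hypothesis muT : forall A, measurable A -> mu (T @^-1` A) = mu A.
Hypothesis partP : is_partition P.

Fixpoint cyl (w : seq (set X)) : set X :=
  if w is a :: w' then a `&` T @^-1` cyl w' else setT.

Definition cyl_weight w : R := fine (mu (cyl w)).

Lemma measurable_preim A : measurable A -> measurable (T @^-1` A).
Proof. by move=> mA; rewrite -[_ @^-1` _]setTI; exact: mT. Qed.

Lemma measurable_cyl n w : w \in words P n -> measurable (cyl w).
Proof.
have [mP _] := partP; elim: w n => [|a w IHw] n //=.
rewrite mem_words => /andP[_ /= /andP[Pa Pw]].
apply: measurableI; first exact: mP.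
by apply/measurable_preim/(IHw (size w)); rewrite mem_words eqxx.
Qed.

Lemma cyl_cat u v : cyl (u ++ v) = cyl u `&` (iter (size u) T @^-1` cyl v).
Proof.
elim: u => [|a u IHu] /=; first by rewrite setTI.
rewrite IHu preimage_setI setIA; congr (_ `&` _).
by apply/seteqP; split => x /=; rewrite -iterSr.
Qed.

Lemma big_join_iter (F : set X -> R) n :
  \sum_(A <- join_iter T P n) F A = \sum_(w <- words P n) F (cyl w).
Proof.
elim: n F => [|n IHn] F; first by rewrite !big_seq1.
rewrite big_words_rcons /= big_allpairs_dep.
rewrite (IHn (fun A => \sum_(B <- P) F (A `&` iter n T @^-1` B))).
apply: eq_big_seq => w /size_words sw; apply: eq_bigr => a _.
by rewrite -cats1 cyl_cat /= preimage_setT setIT sw.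
Qed.

Lemma sum_partition B : measurable B ->
  \sum_(a <- P) fine (mu (a `&` B)) = fine (mu B).
Proof.
have [mP [trP covP]] := partP => mB.
(* Blocks are indexed by position, as the empty block may occur repeatedly in [P]. *)
pose F (i : 'I_(size P)) := nth set0 P i `&` B.
have mF i : measurable (F i).
  by apply: measurableI => //; apply/mP/mem_nth.
have E : B = \big[setU/set0]_(i < size P | true) F i.
  rewrite -bigcup_seq; apply/seteqP; split => [x Bx|x [i _ []]//].
  have : (\bigcup_(A in [set A | A \in P]) A) x by rewrite covP.
  move=> [A /= PA Ax].
  have ltA : (index A P < size P)%N by rewrite index_mem.
  exists (Ordinal ltA); first by rewrite /= mem_index_enum.
  by split=> //=; rewrite nth_index.
rewrite [in RHS]E measure_bigsetU_ord//; last first.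
  apply/trivIsetP => i j _ _ ij; rewrite /F setIACA trP ?set0I//.
  by move/ord_inj/eqP; rewrite (negbTE ij).
rewrite -sum_fine; last by move=> i _; exact: fin_num_measure.
by rewrite (big_nth set0) big_mkord.
Qed.

Lemma stationary_cyl : stationary P cyl_weight.
Proof.
split=> [w| |n w Pw].
- exact: fine_ge0.
- by rewrite /cyl_weight /= probability_setT.
- rewrite /cyl_weight /= sum_partition; last exact/measurable_preim/measurable_cyl/Pw.
  by rewrite muT//; exact/measurable_cyl/Pw.
Qed.

Lemma exists_cyl n x : exists2 w, w \in words P n & cyl w x.
Proof.
have [_ [_ covP]] := partP.
elim: n x => [|n IHn] x; first by exists [::]; rewrite ?mem_words.
have : (\bigcup_(A in [set A | A \in P]) A) x by rewrite covP.
move=> [A /= PA Ax]; have [w Pw wx] := IHn (T x).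
move: Pw; rewrite mem_words => /andP[sw Pw].
by exists (A :: w) => //; rewrite mem_words /= eqSS sw PA.
Qed.

Lemma exists_cyl_extend n m w x : (n <= m)%N -> w \in words P n -> cyl w x ->
  exists v, [/\ v \in words P m, cyl v x & take n v = w].
Proof.
move=> nm Pw wx; have [u Pu ux] := exists_cyl (m - n) (iter n T x).
exists (w ++ u); split.
- by rewrite -(subnKC nm); exact: words_cat.
- by rewrite cyl_cat (size_words Pw).
- by rewrite -(size_words Pw) take_size_cat.
Qed.

Definition cyl_union n (Q : pred (seq (set X))) : set X :=
  \big[setU/set0]_(w <- words P n | Q w) cyl w.

Lemma cyl_unionP n Q x :
  cyl_union n Q x <-> exists w, [/\ w \in words P n, Q w & cyl w x].
Proof.
rewrite /cyl_union -bigcup_seq_cond; split=> [[w /= /andP[]]|[w [Pw Qw wx]]].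
  by exists w.
by exists w => //=; rewrite Pw.
Qed.

Lemma measurable_cyl_union n Q : measurable (cyl_union n Q).
Proof.
rewrite /cyl_union big_seq_cond; apply: bigsetU_measurable => w /andP[Pw _].
exact: measurable_cyl Pw.
Qed.

Lemma fine_mu_setU A B : measurable A -> measurable B ->
  fine (mu (A `|` B)) <= fine (mu A) + fine (mu B).
Proof.
move=> mA mB; have mAB := measurableU _ _ mA mB.
rewrite -lee_fin EFinD !fineK ?fin_num_measure//.
exact: measureU2.
Qed.

Lemma cyl_union_le n Q :
  fine (mu (cyl_union n Q)) <= \sum_(w <- words P n | Q w) cyl_weight w.
Proof.
rewrite /cyl_union; have : {subset words P n <= words P n} by [].
elim: {1 3 4}(words P n) => [|w s IHs] sP; first by rewrite !big_nil measure0.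
have mw : measurable (cyl w) by apply: measurable_cyl (sP _ _); rewrite mem_head.
have {}IHs := IHs (fun v vs => sP v (mem_behead (s := w :: s) vs)).
rewrite !big_cons; case: ifP => // _.
apply: le_trans (fine_mu_setU _ _) _ => //.
  rewrite big_seq_cond; apply: bigsetU_measurable => v /andP[vs _].
  by apply: measurable_cyl (sP _ _); rewrite in_cons vs orbT.
by rewrite lerD2l.
Qed.

(** Complementation replaces additivity: the unions for [Q] and [predC Q] cover the space, and
    subadditivity bounds the second by the weights of the words outside [Q]. *)
Lemma le_cyl_union n Q :
  \sum_(w <- words P n | Q w) cyl_weight w <= fine (mu (cyl_union n Q)).
Proof.
have := stationary_sum1 n stationary_cyl; rewrite (bigID Q) /=.
have := cyl_union_le n (predC Q); rewrite /=.
have : (1 : R) <= fine (mu (cyl_union n Q)) + fine (mu (cyl_union n (predC Q))).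
  rewrite [leLHS](_ : _ = fine (mu (cyl_union n Q `|` cyl_union n (predC Q)))).
    by apply: fine_mu_setU; exact: measurable_cyl_union.
  rewrite [X in mu X](_ : _ = setT) ?probability_setT//.
  apply/seteqP; split => // x _.
  have [w Pw wx] := exists_cyl n x.
  have [Qw|Qw] := boolP (Q w); [left|right]; apply/cyl_unionP; exists w; split=> //=.
by set u := \sum_(_ <- _ | _) _; set v := \sum_(_ <- _ | _) _; lra.
Qed.

End Cylinders.

(** * Linear growth rates and geometric tails *)

Section Rates.
Local Open Scope ring_scope.
Variable R : realType.

Lemma limn_esup_div_le (a : nat -> R) (b K : R) :
  (\forall n \near \oo, a n <= n%:R * b + K) ->
  (limn_esup (fun n => (n%:R^-1 * a n)%:E) <= b%:E)%E.
Proof.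
move=> Ha; apply/lee_addgt0Pr => e e0; apply: limf_esup_le => /=.
near=> n; rewrite /= -EFinD lee_fin.
have n0 : 0 < n%:R :> R by rewrite ltr0n; near: n; exact: nbhs_infty_gt.
rewrite mulrC ler_pdivrMr// [leRHS]mulrC mulrDr.
apply: le_trans (_ : n%:R * b + K <= _); first by near: n.
rewrite lerD2l -ler_pdivrMr//.
by near: n; exact: nbhs_infty_ger.
Unshelve. all: by end_near. Qed.

(** Supplies the minimal block length for which the length weights take up only half of Kraft's
    budget. *)
Lemma geometric_tail (r : R) : 0 < r < 1 ->
  exists2 m, (0 < m)%N & forall N, \sum_(m <= n < N) r ^+ n <= 2^-1.
Proof.
move=> /andP[r0 r1]; have nr : `|r| < 1 by rewrite gtr0_norm.
have /cvgr_lt/(_ _ (_ : 0 < 2^-1)) := @cvg_geometric R (1 - r)^-1 r nr.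
rewrite invr_gt0 ltr0n => /(_ isT) [m _ Hm].
exists m.+1 => // N.
have [Nm|mN] := leqP N m.+1; first by rewrite big_geq// invr_ge0.
rewrite -(subnKC (ltnW mN)) geometric_partial_tail.
apply: le_trans (geometric_le_lim _ _ _ nr) _ => //.
  by rewrite exprn_ge0// ltW.
by rewrite mulrC; apply/ltW/(Hm m.+1)/leqnSn.
Qed.

End Rates.

(** * One half of the Shannon-McMillan theorem *)

Section ShannonMcMillan.
Local Open Scope ring_scope.
Variables (R : realType) (d : measure_display) (X : measurableType d).
Variables (mu : probability X R) (T : X -> X) (P : seq (set X)).
Hypothesis mT : measurable_fun setT T.
Hypothesis muT : forall A, measurable A -> mu (T @^-1` A) = mu A.
Hypothesis partP : is_partition P.

Notation wt := (cyl_weight mu T).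

Lemma measurable_iter A n : measurable A -> measurable (iter n T @^-1` A).
Proof.
elim: n A => [//|n IHn] A mA.
by rewrite (_ : _ @^-1` _ = iter n T @^-1` (T @^-1` A))//; exact/IHn/measurable_preim.
Qed.

Lemma mu_iter A n : measurable A -> mu (iter n T @^-1` A) = mu A.
Proof.
elim: n A => [//|n IHn] A mA.
rewrite (_ : _ @^-1` _ = iter n T @^-1` (T @^-1` A))// IHn ?muT//.
exact: measurable_preim.
Qed.

(** The iterated preimages of [E] increase and all have measure [mu E]; their union is invariant and
    has measure [mu E] too. *)
Lemma ergodic_subinvariant E : ergodic mu T -> measurable E ->
  E `<=` T @^-1` E -> mu E = 0%E \/ mu E = 1%E.
Proof.
move=> ergT mE subE; pose F k := iter k T @^-1` E.
have mF k : measurable (F k) by exact: measurable_iter.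
have mUF : measurable (\bigcup_k F k) by exact: bigcupT_measurable.
have homoF : {homo F : n m / (n <= m)%N >-> (n <= m)%O}.
  apply: homo_leq; [exact: lexx|exact: le_trans|].
  by move=> k; apply/subsetPset => x Fx; exact: subE.
have cvE : (mu \o F) k @[k --> \oo] --> mu E.
  by apply: cvg_near_cst; apply: nearW => k; exact: mu_iter.
rewrite (cvg_unique _ cvE (nondecreasing_cvg_mu mF mUF homoF))//.
apply: ergT => //; apply/seteqP; split => x [k _ Fx].
  by exists k.+1 => //; rewrite /F /= -iterS iterSr.
by have := subE _ Fx; rewrite /= -iterS iterSr => Fx'; exists k.
Qed.

(* The points whose [n]-cylinder has weight at least [exp (- (n c + K))] for
   infinitely many [n]; the constant [K] makes the set subinvariant. *)
Definition heavy_set (c : R) : set X :=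
  \bigcup_K \bigcap_m \bigcup_(n in [set n | (m <= n)%N])
    cyl_union T P n (fun w => expR (- (n%:R * c + K%:R)) <= wt w).

Lemma measurable_heavy_set c : measurable (heavy_set c).
Proof.
apply: bigcupT_measurable => K; apply: bigcapT_measurable => m.
by apply: bigcup_measurable => n _; exact: measurable_cyl_union.
Qed.

Lemma heavy_set_subinvariant c : 0 <= c -> heavy_set c `<=` T @^-1` heavy_set c.
Proof.
(* Dropping the first letter lowers [n] by one, which costs [c] in the exponent; the larger constant
   absorbs it. *)
move=> c0 x [K _ HK]; exists (K + Num.bound c)%N => // m _.
have [[//|n] /= mn /cyl_unionP[w [Pw Hw wx]]] := HK m.+1 I.
exists n => //=; case: w Pw Hw wx => [|a w]; rewrite mem_words//=.
move=> /andP[sw /andP[Pa Pw]] Hw [ax wx]; have Pnw : w \in words P n.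
  by rewrite mem_words Pw andbT -eqSS.
apply/cyl_unionP; exists w; split => //.
apply: le_trans (stationary_cons_le (stationary_cyl mT muT partP) Pnw Pa).
apply: le_trans Hw; rewrite ler_expR natrD -[in leRHS]addn1 [(n + 1)%:R]natrD.
have := archi_boundP c0; lra.
Qed.

(** Almost every point has a heavy prefix of length at least [m], so by continuity from below long
    words are bad with probability at most [dl], and [entropy_le_code] applies. *)
Lemma entropy_le_heavy c e : 0 <= c -> 0 < e -> mu (heavy_set c) = 1%E ->
  exists C, forall N, \sum_(w <- words P N) Defs.eta (wt w) <= N%:R * (c + e) + C.
Proof.
(* One third absorbs the constant [K] of [heavy_set], one pays for block lengths, one for single
   letters. *)
move=> c0 e0 muE; pose e' := e / 3.
have e'0 : 0 < e' by rewrite divr_gt0.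
have stP := stationary_cyl mT muT partP.
have [m m0 geom] : exists2 m, (0 < m)%N &
    forall N, \sum_(m <= n < N) expR (- e') ^+ n <= 2^-1.
  by apply: geometric_tail; rewrite expR_gt0 expR_lt1 oppr_lt0.
pose K0 : R := ln ((size P)%:R *+ 2).
have K00 : 0 <= K0 := ln_double_size_ge0 stP.
pose dl := e' / (K0 + 1).
have dl0 : 0 < dl by rewrite divr_gt0// ltr_wpDl.
pose good := has_short_prefix wt m (c + e').
pose U L := cyl_union T P L good.
have mU L : measurable (U L) by exact: measurable_cyl_union.
have homoU : {homo U : n m / (n <= m)%N >-> (n <= m)%O}.
  move=> L M LM; apply/subsetPset => x /cyl_unionP[w [Pw gw wx]].
  have [v [Pv vx vw]] := exists_cyl_extend partP LM Pw wx.
  apply/cyl_unionP; exists v; split => //.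
  move: gw => /hasP[n]; rewrite mem_index_iota ltnS => /andP[mn nw] Hn.
  have nL : (n <= L)%N by rewrite -(size_words Pw).
  apply/hasP; exists n.
    by rewrite mem_index_iota mn ltnS (size_words Pv) (leq_trans nL).
  by move: Hn; rewrite -vw take_takel.
have mUU : measurable (\bigcup_L U L) by exact: bigcupT_measurable.
have muU : mu (\bigcup_L U L) = 1%E.
  apply/eqP; rewrite eq_le probability_le1//= -muE.
  apply: le_measure; rewrite ?inE//; first exact: measurable_heavy_set.
  (* Once [n >= K / e'], the constant [K] is at most [n * e'], so the whole [n]-word is a heavy
     block at rate [c + e']. *)
  move=> x [K _ HK].
  have [n /= mn /cyl_unionP[w [Pw Hw wx]]] :=
    HK (m + Num.bound (K%:R / e'))%N I.
  exists n => //; apply/cyl_unionP; exists w; split => //.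
  apply/hasP; exists n; first by rewrite mem_index_iota (size_words Pw) leqnn
    (leq_trans (leq_addr _ _) mn).
  rewrite take_oversize ?(size_words Pw)//; apply: le_trans Hw.
  rewrite ler_expR lerN2 mulrDr lerD2l -ler_pdivrMr//.
  apply: (@le_trans _ _ (Num.bound (K%:R / e'))%:R).
    by apply/ltW/archi_boundP; rewrite divr_ge0// ltW.
  by rewrite ler_nat (leq_trans _ mn)// leq_addl.
have : fine (mu (U L)) @[L --> \oo] --> (1 : R).
  apply: fine_cvg; rewrite -[1%:E]muU.
  exact: (@nondecreasing_cvg_mu _ _ _ mu _ mU mUU homoU).
move=> /cvgr_gt/(_ (1 - dl)).
rewrite ltrBlDl ltrDr => /(_ dl0)[M _ HM].
have Hdl L : (M <= L)%N -> \sum_(w <- words P L | ~~ good w) wt w <= dl.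
  move=> /HM /= HU; have := cyl_union_le mu mT partP L good.
  have := stationary_sum1 L stP; rewrite (bigID good) /=.
  move: HU; rewrite -/(U L).
  set u := \sum_(_ <- _ | _) _; set v := \sum_(_ <- _ | _) _; lra.
have ce0 : 0 <= c + e' by rewrite addr_ge0// ltW.
exists (K0 * M%:R) => N.
apply: le_trans (entropy_le_code stP m0 ce0 e'0 geom (ltW dl0) Hdl N) _.
rewrite -/K0; have Kdl : K0 * dl <= e'.
  by rewrite mulrA ler_pdivrMr ?ltr_wpDl// mulrC ler_wpM2l ?lerDl// ltW.
have := ler_wpM2l (ler0n R N) Kdl; have -> : e = e' *+ 3 by rewrite /e'; field.
by move: (dl) => D; lra.
Qed.

(** If [heavy_set c] had measure [1], the entropy would be at most [c]; so it is null. Its part with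
    [K = 0] is the upper limit of the unions of heavy [n]-cylinders, whose measures therefore tend
    to [0]. *)
Lemma heavy_cyl_vanish c : ergodic mu T -> 0 <= c ->
  (c%:E < dyn_gentropy mu Defs.eta T P)%E -> forall e, 0 < e ->
  \forall n \near \oo,
    \sum_(w <- words P n | expR (- (n%:R * c)) <= wt w) wt w <= e.
Proof.
move=> ergT c0 ch e e0.
have [E0|E1] := ergodic_subinvariant ergT (measurable_heavy_set c)
  (heavy_set_subinvariant c0); last first.
  suff : (dyn_gentropy mu Defs.eta T P <= c%:E)%E by rewrite leNgt ch.
  apply/lee_addgt0Pr => e1 e10.
  have [C HC] := entropy_le_heavy c0 e10 E1.
  rewrite -EFinD; apply: (@limn_esup_div_le _ _ _ C); apply: nearW => n.
  by rewrite /Hg big_join_iter.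
pose F n := cyl_union T P n (fun w => expR (- (n%:R * c)) <= wt w).
pose V m := \bigcup_(n in [set n | (m <= n)%N]) F n.
have mF n : measurable (F n) by exact: measurable_cyl_union.
have mV m : measurable (V m) by apply: bigcup_measurable.
have mVV : measurable (\bigcap_m V m) by exact: bigcapT_measurable.
have homoV : {homo V : n m / (n <= m)%N >-> (m <= n)%O}.
  move=> n m nm; apply/subsetPset => x [k /= mk Fx]; exists k => //=.
  exact: leq_trans nm mk.
have V0 : mu (\bigcap_m V m) = 0%E.
  apply/eqP; rewrite -measure_le0 -E0; apply: le_measure; rewrite ?inE//.
    exact: measurable_heavy_set.
  move=> x Vx; exists 0%N => // m _; have [n mn Fx] := Vx m I; exists n => //.
  by under eq_fun do rewrite addr0.
have V0fin : (mu (V 0%N) < +oo)%E by rewrite -ge0_fin_numE// fin_num_measure.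
have : fine (mu (V m)) @[m --> \oo] --> (0 : R).
  apply: fine_cvg; rewrite -[0%:E]V0.
  exact: (@nonincreasing_cvg_mu _ _ _ mu V V0fin mV mVV homoV).
move=> /cvgr_lt/(_ _ e0)[M _ HM]; exists M => // n /HM /= Vn.
apply: le_trans (le_cyl_union mT muT partP _ _) (le_trans _ (ltW Vn)).
apply: fine_le; rewrite ?fin_num_measure//; first exact: mF.
apply: le_measure; rewrite ?inE //; first exact: mF.
by move=> x Fx; exists n => /=.
Qed.

Lemma dyn_entropy_le_ln_size : (dyn_gentropy mu Defs.eta T P <= (ln (size P)%:R)%:E)%E.
Proof.
apply: (@limn_esup_div_le _ _ _ 0); apply: nearW => n; rewrite addr0 /Hg big_join_iter.
exact: entropy_le_ln_size (stationary_cyl mT muT partP).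
Qed.

End ShannonMcMillan.

(** * Approximation of products, and concave functions against [eta] *)

Section RealFacts.
Local Open Scope ring_scope.
Variable R : realType.

(** Infinitely many [n] suffice for a lower bound on an upper limit; half of the error is spent on
    [K / n]. *)
Lemma limn_esup_div_ge (a : nat -> R) (b K : R) :
  (forall e N, 0 < e -> exists2 n, (N <= n)%N & n%:R * (b - e) - K <= a n) ->
  (b%:E <= limn_esup (fun n => (n%:R^-1 * a n)%:E))%E.
Proof.
move=> Ha; apply/lee_addgt0Pr => e e0; rewrite -leeBlDr// -EFinB.
apply: le_limf_esup => V [N _ NV].
have e20 : 0 < e / 2 by rewrite divr_gt0.
have [n nN Hn] := Ha _ (maxn N (Num.bound (`|K| / (e / 2))).+1) e20.
move: nN; rewrite geq_max => /andP[Nn Kn].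
exists n; first exact: NV.
have n0 : 0 < n%:R :> R by rewrite ltr0n (leq_trans _ Kn).
rewrite lee_fin ler_pdivlMl//; apply: le_trans Hn.
suff : K <= n%:R * (e / 2) by rewrite !mulrBr; lra.
apply: le_trans (ler_norm K) _; rewrite -ler_pdivrMr//.
apply: (@le_trans _ _ (Num.bound (`|K| / (e / 2)))%:R).
  by apply/ltW/archi_boundP; rewrite divr_ge0// ltW.
by rewrite ler_nat ltnW.
Qed.

Lemma le_mulr_approx (a b : R) (z : \bar R) : 0 <= a -> 0 <= b ->
  (forall e, 0 < e -> (z <= ((a + e) * (b + e))%:E)%E) -> (z <= (a * b)%:E)%E.
Proof.
move=> a0 b0 H; apply/lee_addgt0Pr => e e0.
have s0 : 0 < a + b + 1 by rewrite ltr_wpDl ?addr_ge0.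
(* As [t <= 1], [(a + t) * (b + t)] exceeds [a * b] by at most [t * (a + b + 1)]. *)
pose t := Num.min 1 (e / (a + b + 1)).
have t0 : 0 < t by rewrite /t lt_min ltr01 divr_gt0.
have t1 : t <= 1 by rewrite /t ge_min lexx.
have te : t * (a + b + 1) <= e by rewrite -ler_pdivlMr// /t ge_min lexx orbT.
apply: le_trans (H t t0) _; rewrite -EFinD lee_fin.
have := ler_wpM2l (ltW t0) t1; move: te; rewrite !mulrDr !mulrDl; lra.
Qed.

Lemma mulr_approx_le (a b : R) (z : \bar R) : 0 < a -> 0 < b ->
  (forall x y, 0 < x < a -> 0 < y < b -> ((x * y)%:E <= z)%E) -> ((a * b)%:E <= z)%E.
Proof.
move=> a0 b0 H; apply/lee_addgt0Pr => e e0.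
have s0 : 0 < 2 * (a * b) by rewrite !mulr_gt0.
(* Scaling both factors by [1 - t] loses at most [2 * t * a * b]; [t <= 1/2] keeps them positive. *)
pose t := Num.min 2^-1 (e / (2 * (a * b))).
have t0 : 0 < t by rewrite /t lt_min invr_gt0 ltr0n divr_gt0.
have t1 : t <= 2^-1 by rewrite /t ge_min lexx.
have te : t * (2 * (a * b)) <= e by rewrite -ler_pdivlMr// /t ge_min lexx orbT.
have t1' : 0 < 1 - t by lra.
rewrite -leeBlDr// -EFinB; apply: le_trans (H ((1 - t) * a) ((1 - t) * b) _ _).
- rewrite lee_fin; have := mulr_ge0 (mulr_ge0 (ltW t0) (ltW t0)) (ltW (mulr_gt0 a0 b0)).
  by move: te; lra.
- by rewrite mulr_gt0//= gtr_pMl// ltrBlDr ltrDl.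
- by rewrite mulr_gt0//= gtr_pMl// ltrBlDr ltrDl.
Qed.

Lemma eta0 : Defs.eta (0 : R) = 0. Proof. by rewrite /Defs.eta lexx. Qed.

Lemma etaE (x : R) : 0 < x -> Defs.eta x = x * - ln x.
Proof. by move=> x0; rewrite /Defs.eta leNgt x0 mulrN. Qed.

Lemma eta_ge0 (x : R) : 0 <= x <= 1 -> 0 <= Defs.eta x.
Proof.
move=> /andP[]; rewrite le_eqVlt => /predU1P[<-|x0 x1]; first by rewrite eta0.
by rewrite etaE//; apply: mulr_ge0; [exact: ltW|rewrite oppr_ge0 ln_le0].
Qed.

Lemma eta_gt0 (x : R) : 0 < x < 1 -> 0 < Defs.eta x.
Proof.
by move=> /andP[x0 x1]; rewrite etaE// mulr_gt0// oppr_gt0 ln_lt0// x0.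
Qed.

Lemma near0_itv (y : R) : 0 < y -> \forall x \near 0^'+, 0 < x < y.
Proof.
move=> y0; near=> x; apply/andP; split; near: x.
  exact: nbhs_right_gt.
exact: nbhs_right_lt.
Unshelve. all: by end_near. Qed.

Variable g : R -> R.
Hypothesis G0g : G0 g.

(** Concavity on the segment from [0] to [x], with [g 0 = 0]: the quotient [g x / x] is
    nonincreasing. *)
Lemma G0_star (x y : R) : 0 < x <= 1 -> 0 <= y <= x -> y / x * g x <= g y.
Proof.
have [gc [g0 _]] := G0g; move=> /andP[x0 x1] /andP[y0 yx].
have := gc x 0 (y / x); rewrite g0 !mulr0 !addr0 divfK ?gt_eqF//; apply.
- by rewrite ltW.
- by rewrite lexx ler01.
- by rewrite divr_ge0 ?(ltW x0)//= ler_pdivrMr// mul1r.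
Qed.

(** Controls negative values of [g]: their total over a partition stays bounded below. *)
Lemma G0_ge_line (x : R) : 0 <= x <= 1 -> x * g 1 <= g x.
Proof.
by move=> x01; have := @G0_star 1 x; rewrite divr1; apply; rewrite ?ltr01 ?lexx.
Qed.

Lemma G0_le_eta (C : R) : 0 <= C ->
  (\forall x \near 0^'+, g x <= C * Defs.eta x) ->
  exists2 K, 0 <= K & forall x, 0 <= x <= 1 -> g x <= C * Defs.eta x + K * x.
Proof.
have [_ [g0 _]] := G0g; move=> C0 [e /= e0 He].
pose y := Num.min 1 (e / 2).
have y0 : 0 < y by rewrite /y lt_min ltr01 divr_gt0.
have y1 : y <= 1 by rewrite /y ge_min lexx.
have ye : y < e.
  by rewrite /y gt_min ltr_pdivrMr// ltr_pMr// ltr1n orbT.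
exists `|g y / y| => // x /andP[x0 x1].
have [xy|yx] := ltP x y.
  rewrite ler_wpDr ?mulr_ge0//.
  move: x0; rewrite le_eqVlt => /predU1P[<-|x0]; first by rewrite g0 eta0 mulr0.
  apply: He => //=; rewrite sub0r normrN gtr0_norm//.
  exact: lt_trans ye.
have x00 : 0 < x by exact: lt_le_trans yx.
rewrite ler_wpDl ?mulr_ge0 ?eta_ge0 ?x0//.
apply: le_trans (ler_wpM2r x0 (ler_norm _)).
have := @G0_star x y; rewrite x00 x1 yx ltW// => /(_ isT isT).
by rewrite mulrAC ler_pdivrMr// mulrAC ler_pdivlMr// mulrC.
Qed.

End RealFacts.

(** * Comparing the entropies of [g] and [eta] on one partition *)

Section Transfer.
Local Open Scope ring_scope.
Variables (R : realType) (d : measure_display) (X : measurableType d).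
Variables (mu : probability X R) (T : X -> X).
Hypothesis mT : measurable_fun setT T.
Hypothesis muT : forall A, measurable A -> mu (T @^-1` A) = mu A.

Notation wt := (cyl_weight mu T).

Lemma cyl_weight01 P n w : is_partition P -> w \in words P n -> 0 <= wt w <= 1.
Proof.
move=> partP Pw; rewrite fine_ge0//= -lee_fin fineK ?fin_num_measure//.
  by apply: probability_le1; exact: measurable_cyl Pw.
exact: measurable_cyl Pw.
Qed.

Lemma dyn_gentropy_ge0 (g : R -> R) b P : is_partition P ->
  (forall x, 0 <= x <= 1 -> x * b <= g x) -> (0 <= dyn_gentropy mu g T P)%E.
Proof.
move=> partP Hg'; apply: (@limn_esup_div_ge _ _ 0 `|b|) => e N e0.
exists N => //; rewrite /Hg big_join_iter.
apply: le_trans (_ : \sum_(w <- words P N) wt w * b <= _).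
  rewrite -mulr_suml (stationary_sum1 _ (stationary_cyl mT muT partP)) mul1r.
  have := mulr_ge0 (ler0n R N) (ltW e0); have := ler_norm (- b); rewrite normrN.
  by lra.
by rewrite big_seq [leRHS]big_seq ler_sum// => w /(cyl_weight01 partP)/Hg'.
Qed.

Lemma dyn_gentropy_le (g : R -> R) C y P : is_partition P -> G0 g -> 0 <= C ->
  (\forall x \near 0^'+, g x <= C * Defs.eta x) ->
  (dyn_gentropy mu Defs.eta T P < y%:E)%E -> (dyn_gentropy mu g T P <= (C * y)%:E)%E.
Proof.
move=> partP G0g C0 gC etay; have [K K0 HK] := G0_le_eta G0g C0 gC.
apply: (@limn_esup_div_le _ _ _ K).
have Hy := limf_esup_lt _ etay.
near=> n; have n0 : 0 < n%:R :> R by rewrite ltr0n; near: n; exact: nbhs_infty_gt.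
have : Hg mu Defs.eta (join_iter T P n) <= n%:R * y.
  by rewrite -ler_pdivrMl// -lee_fin; apply: ltW; near: n; exact: Hy.
rewrite /Hg !big_join_iter => H.
apply: le_trans (_ : \sum_(w <- words P n) (C * Defs.eta (wt w) + K * wt w) <= _).
  by rewrite big_seq [leRHS]big_seq ler_sum// => w /(cyl_weight01 partP)/HK.
rewrite big_split /= -!mulr_sumr (stationary_sum1 _ (stationary_cyl mT muT partP)).
by rewrite mulr1 lerD2r mulrCA ler_wpM2l.
Unshelve. all: by end_near. Qed.

(* As [g x / x] decreases, [g x >= C * eta x] at one small [x] bounds [g] below
   by [y * C * - ln x] at every [y <= x]; for [n] close to [- ln x / c] almost
   all of the mass sits on cylinders of weight below [x]. *)
Lemma dyn_gentropy_ge (g : R -> R) C c P : ergodic mu T -> is_partition P ->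
  G0 g -> 0 < C -> (C%:E < Cbar g)%E -> 0 < c ->
  (c%:E < dyn_gentropy mu Defs.eta T P)%E -> ((C * c)%:E <= dyn_gentropy mu g T P)%E.
Proof.
move=> ergT partP G0g C0 gC c0 ch.
have stP := stationary_cyl mT muT partP.
(* [C * c] is the price of rounding [u / c] up to an integer, [|g 1|] that of the linear lower bound
   on [g]. *)
apply: (@limn_esup_div_ge _ _ _ (C * c + `|g 1|)) => e N e0.
(* Heavy mass at most [e / (C * c)] loses at most [(u / c) * e <= n * e]. *)
have dl0 : 0 < e / (C * c) by rewrite divr_gt0// mulr_gt0.
have [M _ HM] := heavy_cyl_vanish mT muT partP ergT (ltW c0) ch dl0.
pose n0 := (maxn N M).+1.
have [x /= /andP[x0 xn0]] := limf_esup_gt gC (near0_itv (expR_gt0 (- (n0%:R * c)))).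
rewrite lte_fin; set u := - ln x.
have un0 : n0%:R * c < u.
  by rewrite /u ltrNr -ltr_expR lnK.
have u0 : 0 < u by apply: lt_trans un0; rewrite mulr_gt0// ltr0n.
have x1 : x < 1 by rewrite -[x]lnK ?posrE// -expR0 ltr_expR -oppr_gt0.
have etax : Defs.eta x = x * u by rewrite etaE.
rewrite etax ltr_pdivlMr ?mulr_gt0// => gx.
have /andP[tu ut] : (Num.truncn (u / c))%:R <= u / c < (Num.truncn (u / c)).+1%:R.
  by apply: truncn_itv; rewrite divr_ge0// ltW.
(* With this [n], [exp (- n c) < x], while [n * c] exceeds [u] by at most [c]. *)
set n := (Num.truncn (u / c)).+1 in ut.
have n0n : (n0 <= n)%N.
  by rewrite -(ler_nat R) ltW// (lt_trans _ ut)// ltr_pdivlMr.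
have unc : u < n%:R * c by rewrite -ltr_pdivrMr.
have ncu : n%:R * c <= u + c.
  by move: tu; rewrite ler_pdivlMr// /n -addn1 natrD mulrDl mul1r lerD2r.
exists n; first by rewrite (leq_trans _ n0n)// /n0 leqW// leq_maxl.
rewrite /Hg big_join_iter.
have /HM /= : (M <= n)%N by rewrite (leq_trans _ n0n)// /n0 leqW// leq_maxr.
rewrite big_mkcond /=; set S := \sum_(_ <- _) _ => HS.
(* Heavy cylinders keep only [- wt w * |g 1|]; on the light ones, of weight below [x], [G0_star]
   even gives [wt w * (C * u)]. *)
apply: le_trans (_ : \sum_(w <- words P n) (wt w * (C * u) - wt w * `|g 1| -
   (if expR (- (n%:R * c)) <= wt w then wt w else 0) * (C * u)) <= _).
  rewrite !sumrB -!mulr_suml (stationary_sum1 _ stP) -/S !mul1r.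
  have Cu0 : 0 < C * u by rewrite mulr_gt0.
  have H1 := ler_wpM2r (ltW Cu0) HS.
  have H2 : e / (C * c) * (C * u) <= n%:R * e.
    rewrite [leLHS](_ : _ = (u / c) * e).
      by rewrite ler_pM2r// ltW.
    by field; rewrite !gt_eqF.
  have := ler_wpM2l (ltW C0) ncu.
  rewrite mulrBr; lra.
rewrite big_seq [leRHS]big_seq ler_sum// => w Pw.
have /andP[w0 w1] := cyl_weight01 partP Pw.
have wg : 0 <= wt w * `|g 1| by rewrite mulr_ge0.
case: ifPn => [_|]; last first.
  rewrite -ltNge mul0r subr0 => wn.
  have wx : wt w <= x.
    rewrite ltW// (lt_trans wn)// -[ltRHS]lnK ?posrE// ltr_expR.
    by rewrite ltrNl.
  apply: le_trans (G0_star G0g _ (_ : 0 <= wt w <= x)); last 2 first.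
    by rewrite x0 ltW.
    by rewrite w0.
  apply: le_trans (_ : wt w * (C * u) <= _); first by rewrite gerBl.
  rewrite -mulrA ler_wpM2l// [leRHS]mulrC ler_pdivlMr//.
  by rewrite -mulrA [u * x]mulrC ltW.
apply: le_trans (G0_ge_line G0g (_ : 0 <= wt w <= 1)); last by rewrite w0.
have := ler_wpM2l w0 (ler_norm (- g 1)); rewrite normrN; lra.
Qed.

End Transfer.

(** * Suprema over partitions and the three cases *)

Local Open Scope ereal_scope.

Lemma is_partition_setT (d : measure_display) (X : measurableType d) :
  is_partition [:: [set: X]].
Proof.
split=> [A|]; first by rewrite inE => /eqP->.
split=> [[|i] [|j]//|]; apply/seteqP; split => // x _.
by exists setT => //=; rewrite inE.
Qed.

Theorem mainTheorem1 (R : realType) (d : measure_display) (X : measurableType d)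
    (mu : probability X R) (T : X -> X) (g : R -> R) :
  lebesgue_space mu -> automorphism mu T -> ergodic mu T -> G0 g ->
  [/\ (0 < Cbar g < +oo ->
         (KS_entropy mu T < +oo -> gentropy mu g T = Cbar g * KS_entropy mu T) /\
         (KS_entropy mu T = +oo -> gentropy mu g T = +oo)),
      (G00 g -> gentropy mu g T = 0) &
      (Cbar g = +oo -> 0 < KS_entropy mu T -> gentropy mu g T = +oo)].
Proof.
move=> _ [Tinv [_ [_ [mT [_ [muT _]]]]]] ergT G0g.
have dyn_le P : is_partition P -> dyn_gentropy mu g T P <= gentropy mu g T.
  by move=> partP; apply: ereal_sup_ubound; exists P.
have g_ge0 : 0 <= gentropy mu g T.
  apply: le_trans (dyn_le _ (@is_partition_setT _ X)).
  exact: (dyn_gentropy_ge0 mT muT (@is_partition_setT _ X) (@G0_ge_line _ _ G0g)).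
have KS_ge0 : 0 <= KS_entropy mu T.
  apply: le_trans (ereal_sup_ubound (_ : _ (dyn_gentropy mu Defs.eta T [:: setT]))).
    apply: (dyn_gentropy_ge0 (b := 0%R) mT muT (@is_partition_setT _ X)) => x x01.
    by rewrite mulr0 eta_ge0.
  by exists [:: setT] => //; exact: is_partition_setT.
have lower (C c : R) : (0 < C)%R -> C%:E < Cbar g -> (0 < c)%R ->
    c%:E < KS_entropy mu T -> (C * c)%:E <= gentropy mu g T.
  move=> C0 CC c0 /ereal_sup_gt[_ [P partP <-] cP].
  exact: le_trans (dyn_gentropy_ge mT muT ergT partP G0g C0 CC c0 cP) (dyn_le _ partP).
have near_eta (C : R) : Cbar g < C%:E ->
    \forall x \near 0%R^'+, (g x <= C * Defs.eta x)%R.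
  move=> /limf_esup_lt gC; near=> x.
  have x01 : (0 < x < 1)%R by near: x; exact: near0_itv.
  rewrite -ler_pdivrMr ?eta_gt0// -lee_fin; apply: ltW; near: x; exact: gC.
split=> [/andP[C0 Coo]||Coo h0].
- have Cfin : Cbar g \is a fin_num by rewrite ge0_fin_numE// ltW.
  move: C0; rewrite -(fineK Cfin); set C := fine _ => C0.
  have CE : Cbar g = C%:E by rewrite fineK.
  rewrite lte_fin in C0.
  split=> [hoo|hoo]; last first.
    (* [A] is the product of [C / 2 < Cbar g] and a real number, which lies below the infinite
       entropy. *)
    apply/eqyP => A A0; have C20 : (0 < C / 2)%R by rewrite divr_gt0.
    rewrite -(divfK (lt0r_neq0 C20) A) mulrC.
    apply: lower; rewrite ?hoo ?ltry ?divr_gt0// CE lte_fin.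
    by rewrite ltr_pdivrMr// ltr_pMr// ltr1n.
  have hfin : KS_entropy mu T \is a fin_num by rewrite ge0_fin_numE.
  have hE : KS_entropy mu T = (fine (KS_entropy mu T))%:E by rewrite fineK.
  move: (fine _) hE => h hE.
  have h0 : (0 <= h)%R by rewrite -lee_fin -hE.
  rewrite hE -EFinM; apply/eqP; rewrite eq_le; apply/andP; split.
    apply: ge_ereal_sup => _ [P partP <-].
    apply: le_mulr_approx => [||e e0]; rewrite ?(ltW C0)//.
    apply: dyn_gentropy_le => //.
    + by rewrite addr_ge0// ltW.
    + by apply: near_eta; rewrite CE lte_fin ltrDl.
    + apply: (@le_lt_trans _ _ h%:E); last by rewrite lte_fin ltrDl.
      by rewrite -hE; apply: ereal_sup_ubound; exists P.
  (* Zero entropy leaves no positive [c] for [lower]; there [g_ge0] is the bound. *)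
  have /predU1P[<-|hp] : (0%R == h) || (0 < h)%R by rewrite -le_eqVlt.
    by rewrite mulr0.
  apply: mulr_approx_le => // x y /andP[x0 xC] /andP[y0 yh].
  by apply: lower; rewrite ?CE ?hE ?lte_fin.
- move=> [_ g0]; apply/eqP; rewrite eq_le g_ge0 andbT.
  apply: ge_ereal_sup => _ [P partP <-].
  (* A fixed partition has entropy at most [k] even if [KS_entropy mu T] is infinite, so
     [g <= e / (|k| + 1) * eta] near [0] bounds its rate by [e]. *)
  have := dyn_entropy_le_ln_size mT muT partP; set k := ln _ => etak.
  have k1 : (0 < `|k| + 1)%R by rewrite ltr_wpDl.
  apply/lee_addgt0Pr => e e0; rewrite add0e.
  rewrite -(divfK (lt0r_neq0 k1) e).
  apply: dyn_gentropy_le => //.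
  + by rewrite divr_ge0// ltW.
  + have ek : (0 < e / (`|k| + 1))%R by rewrite divr_gt0.
    move/cvgr_lt/(_ _ ek): g0 => g0; near=> x.
    have x01 : (0 < x < 1)%R by near: x; exact: near0_itv.
    by rewrite -ler_pdivrMr ?eta_gt0//; apply: ltW; near: x.
  + apply: le_lt_trans etak _; rewrite lte_fin.
    by rewrite (le_lt_trans (ler_norm k))// ltrDl.
- have [c c0 ch] : exists2 c : R, (0 < c)%R & c%:E < KS_entropy mu T.
    move: h0; case: (KS_entropy mu T) => [r| |]//= r0; last by exists 1%R; rewrite ?ltry.
    exists (r / 2)%R; rewrite ?divr_gt0//.
    by rewrite lte_fin ltr_pdivrMr// ltr_pMr// ltr1n.
  (* Here [c] is fixed and [A / c] lies below the infinite [Cbar g]. *)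
  apply/eqyP => A A0; rewrite -(divfK (lt0r_neq0 c0) A).
  by apply: lower; rewrite ?Coo ?ltry ?divr_gt0.
Unshelve. all: by end_near. Qed.
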